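(* The proof system $\mathsf{GDEL}$ is sound and complete for the dynamic logic of generalized updates: for every formula $\varphi\in\mathcal{L}_{DEL}$, $\varphi$ is provable in $\mathsf{GDEL}$ if and only if $\varphi$ is valid in the class of all Kripke models (i.e. $\mathcal{M},w\vDash\varphi$ for every Kripke model $\mathcal{M}$ and every world $w$ of $\mathcal{M}$).
   Context: Language. $At$ is a countable set of atoms, $Ag$ a finite set of agents. The language $\mathcal{L}_{DEL}$ and generalized event models are defined by simultaneous recursion: $\varphi::=\top\mid p\mid\neg\varphi\mid\varphi\wedge\varphi\mid B_a\varphi\mid[\mathcal{E},e]\varphi\mid\forall\varphi$, with $p\in At$, $a\in Ag$, $\mathcal{E}$ a generalized event model and $e$ an event in it. A generalized event model is $\mathcal{E}=(E,Q,Q^+,pre)$ with $E$ a non-empty finite set, $Q_a,Q_a^+\subseteq E\times E$ for each $a\in Ag$, and $pre:E\to\mathcal{L}_{DEL}$ (preconditions being previously constructed formulas). $Q_a(e)=\{f:(e,f)\in Q_a\}$, $Q_a^+(e)=\{f:(e,f)\in Q_a^+\}$. An empty conjunction is $\top$; other connectives are the usual abbreviations. Semantics. A Kripke model is $\mathcal{M}=(W,R,V)$ with $W\neq\emptyset$, $R_a\subseteq W\times W$ arbitrary for each $a\in Ag$, $V:At\to\wp(W)$; $R_a(w)=\{v:(w,v)\in R_a\}$. Atoms and Booleans are standard; $\mathcal{M},w\vDash B_a\varphi$ iff $\mathcal{M},v\vDash\varphi$ for all $v\in R_a(w)$; $\mathcal{M},w\vDash\forall\varphi$ iff $\mathcal{M},v\vDash\varphi$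 for all $v\in W$; $\mathcal{M},w\vDash[\mathcal{E},e]\varphi$ iff: if $\mathcal{M},w\vDash pre(e)$ then $\mathcal{M}\otimes\mathcal{E},(w,e)\vDash\varphi$. Here $\mathcal{M}\otimes\mathcal{E}=(W^{\mathcal E},R^{\mathcal E},V^{\mathcal E})$ with $W^{\mathcal E}=\{(w,e)\in W\times E:\mathcal{M},w\vDash pre(e)\}$; for $(w,e),(v,f)\in W^{\mathcal E}$, $(v,f)\in R_a^{\mathcal E}(w,e)$ iff either $f\in Q_a^+(e)$, or $v\in R_a(w)$ and $f\in Q_a(e)$; $V^{\mathcal E}(p)=\{(w,e)\in W^{\mathcal E}:w\in V(p)\}$. Composition. For $\mathcal{E}=(E^{\mathcal E},Q^{\mathcal E},Q^{+\mathcal E},pre^{\mathcal E})$ and $\mathcal{F}=(E^{\mathcal F},Q^{\mathcal F},Q^{+\mathcal F},pre^{\mathcal F})$, $\mathcal{E}\circ\mathcal{F}=(E,Q,Q^+,pre)$ with $E=E^{\mathcal E}\times E^{\mathcal F}$; $(e',f')\in Q_a((e,f))$ iff $e'\in Q_a^{\mathcal E}(e)$ and $f'\in Q_a^{\mathcal F}(f)$; $(e',f')\in Q_a^+((e,f))$ iff $f'\in Q_a^{+\mathcal F}(f)$, or $f'\in Q_a^{\mathcal F}(f)$ and $e'\in Q_a^{+\mathcal E}(e)$; $pre((e,f))=pre^{\mathcal E}(e)\wedge[\mathcal{E},e]pre^{\mathcal F}(f)$. Proof system $\mathsf{GDEL}$. Axioms (for all formulas, atoms $p$, agents $a$, and generalized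 event models $\mathcal{E},\mathcal{F}$ with events $e,f$): (CL) all classical propositional tautologies; ($\forall$K) $\forall(\varphi\to\psi)\to(\forall\varphi\to\forall\psi)$; ($\forall$T) $\forall\varphi\to\varphi$; ($\forall$5) $\neg\forall\varphi\to\forall\neg\forall\varphi$; ($\forall$B) $\forall\varphi\to B_a\varphi$; (BK) $B_a(\varphi\to\psi)\to(B_a\varphi\to B_a\psi)$; (A1) $[\mathcal{E},e]p\leftrightarrow(pre(e)\to p)$; (A2) $[\mathcal{E},e]\neg\varphi\leftrightarrow(pre(e)\to\neg[\mathcal{E},e]\varphi)$; (A3) $[\mathcal{E},e](\varphi\wedge\psi)\leftrightarrow([\mathcal{E},e]\varphi\wedge[\mathcal{E},e]\psi)$; (A4) $[\mathcal{E},e]\forall\varphi\leftrightarrow(pre(e)\to\bigwedge_{f\in E}\forall[\mathcal{E},f]\varphi)$; (A5) $[\mathcal{E},e]B_a\varphi\leftrightarrow(pre(e)\to(\bigwedge_{f\in Q_a^+(e)}\forall[\mathcal{E},f]\varphi\wedge\bigwedge_{f\in Q_a(e)}B_a[\mathcal{E},f]\varphi))$; (A6) $[\mathcal{E},e][\mathcal{F},f]\varphi\leftrightarrow[\mathcal{E}\circ\mathcal{F},(e,f)]\varphi$. Rules: modus ponens, and necessitation for all modalities (from $\varphi$ infer $\forall\varphi$, $B_a\varphi$, and $[\mathcal{E},e]\varphi$). *)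

(* Defs.v *)
From HB Require Import structures.
From mathcomp Require Import all_boot.

Set Implicit Arguments.
Unset Strict Implicit.
Unset Printing Implicit Defensive.

(* [ev_Q a e f] is f \in Q_a(e), [ev_Qp a e f] is f \in Q^+_a(e).  The frame is
   split off from the preconditions so that [form] can be an ordinary inductive
   type; a generalized event model is a frame with preconditions, see
   [evmodel]. *)
Record evframe (Ag : finType) := EvFrame {
  event :> finType;
  ev_nonempty : 0 < #|event|;
  ev_Q : Ag -> rel event;
  ev_Qp : Ag -> rel event
}.

Inductive form (At : countType) (Ag : finType) : Type :=
| Top
| Atom (p : At)
| Neg (phi : form At Ag)
| And (phi psi : form At Ag)
| Bel (a : Ag) (phi : form At Ag)
| Dyn (F : evframe Ag) (pre : F -> form At Ag) (e : F) (phi : form At Ag)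
| All (phi : form At Ag).

Arguments Top {At Ag}.
Arguments Atom {At Ag} p.

Record evmodel (At : countType) (Ag : finType) := EvModel {
  ev_frame :> evframe Ag;
  ev_pre : ev_frame -> form At Ag
}.

Arguments ev_pre {At Ag} e _ : rename.

Declare Scope del_scope.
Delimit Scope del_scope with del.
Bind Scope del_scope with form.
Local Open Scope del_scope.

Definition Imp (At : countType) (Ag : finType) (phi psi : form At Ag) :=
  Neg (And phi (Neg psi)).

Definition Iff (At : countType) (Ag : finType) (phi psi : form At Ag) :=
  And (Imp phi psi) (Imp psi phi).

Definition Upd (At : countType) (Ag : finType) (E : evmodel At Ag) (e : E)
    (phi : form At Ag) : form At Ag :=
  Dyn (ev_pre E) e phi.

Arguments Upd {At Ag} E e phi.

Notation "~~ phi" := (Neg phi) : del_scope.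
Notation "phi && psi" := (And phi psi) : del_scope.
Notation "phi ==> psi" := (Imp phi psi) : del_scope.
Notation "phi <==> psi" := (Iff phi psi)
  (at level 95, no associativity) : del_scope.

Record kripke (At : countType) (Ag : finType) := Kripke {
  world :> Type;
  world_nonempty : inhabited world;
  acc : Ag -> world -> world -> Prop;
  val_atom : At -> world -> Prop
}.

(* The product update, for [P w e] standing for "w satisfies pre(e)".  A world
   of the product has to be supplied, since the product is not a Kripke model
   when no precondition holds anywhere. *)
Definition product (At : countType) (Ag : finType) (M : kripke At Ag)
    (F : evframe Ag) (P : M -> F -> Prop) (x0 : {x : M * F | P x.1 x.2}) :
    kripke At Ag :=
  {| world := {x : M * F | P x.1 x.2};
     world_nonempty := inhabits x0;
     acc := fun a x y =>
       let: (w, e) := sval x in let: (v, f) := sval y in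
       ev_Qp a e f \/ (acc a w v /\ ev_Q a e f);
     val_atom := fun p x => val_atom p (sval x).1 |}.

Fixpoint sat (At : countType) (Ag : finType) (phi : form At Ag) :
    forall M : kripke At Ag, M -> Prop :=
  match phi with
  | Top => fun M w => True
  | Atom p => fun M w => val_atom p w
  | Neg psi => fun M w => ~ sat psi w
  | And psi chi => fun M w => sat psi w /\ sat chi w
  | Bel a psi => fun M w => forall v : M, acc a w v -> sat psi v
  | Dyn F pre e psi => fun M w =>
      forall h : sat (pre e) w,
        let P := fun (v : M) (f : F) => sat (pre f) v in
        let we : {x : M * F | P x.1 x.2} := exist _ (w, e) h in
        @sat At Ag psi (product we) we
  | All psi => fun M w => forall v : M, sat psi v
  end.

Definition valid (At : countType) (Ag : finType) (phi : form At Ag) :=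
  forall (M : kripke At Ag) (w : M), sat phi w.

Definition comp_frame (Ag : finType) (E F : evframe Ag) : evframe Ag.
Proof.
refine (@EvFrame Ag (E * F)%type _
  (fun a x y => ev_Q a x.1 y.1 && ev_Q a x.2 y.2)%B
  (fun a x y =>
     ev_Qp a x.2 y.2 || (ev_Q a x.2 y.2 && ev_Qp a x.1 y.1))%B).
by rewrite card_prod muln_gt0 !ev_nonempty.
Defined.

Definition ecomp (At : countType) (Ag : finType) (E F : evmodel At Ag) :
    evmodel At Ag :=
  @EvModel At Ag (comp_frame E F)
    (fun x : comp_frame E F => ev_pre E x.1 && Upd E x.1 (ev_pre F x.2)).

(* Propositional evaluation treats every formula whose main connective is not
   Boolean as a propositional variable, so [tautology] holds of exactly the
   substitution instances of classical tautologies. *)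
Fixpoint peval (At : countType) (Ag : finType) (v : form At Ag -> bool)
    (phi : form At Ag) : bool :=
  match phi with
  | Top => true
  | Neg psi => negb (peval v psi)
  | And psi chi => andb (peval v psi) (peval v chi)
  | _ => v phi
  end.

Definition tautology (At : countType) (Ag : finType) (phi : form At Ag) :=
  forall v : form At Ag -> bool, peval v phi = true.

Inductive GDEL (At : countType) (Ag : finType) : form At Ag -> Prop :=
| ax_CL phi : tautology phi -> GDEL phi
| ax_AllK phi psi : GDEL (All (phi ==> psi) ==> (All phi ==> All psi))
| ax_AllT phi : GDEL (All phi ==> phi)
| ax_All5 phi : GDEL (~~ All phi ==> All (~~ All phi))
| ax_AllB a phi : GDEL (All phi ==> Bel a phi)
| ax_BK a phi psi : GDEL (Bel a (phi ==> psi) ==> (Bel a phi ==> Bel a psi))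
| ax_A1 (E : evmodel At Ag) (e : E) p :
    GDEL (Upd E e (Atom p) <==> (ev_pre E e ==> Atom p))
| ax_A2 (E : evmodel At Ag) (e : E) phi :
    GDEL (Upd E e (~~ phi) <==> (ev_pre E e ==> ~~ Upd E e phi))
| ax_A3 (E : evmodel At Ag) (e : E) phi psi :
    GDEL (Upd E e (phi && psi) <==> (Upd E e phi && Upd E e psi))
| ax_A4 (E : evmodel At Ag) (e : E) phi :
    GDEL (Upd E e (All phi) <==>
          (ev_pre E e ==> \big[@And At Ag/Top]_(f : E) All (Upd E f phi)))
| ax_A5 (E : evmodel At Ag) (e : E) a phi :
    GDEL (Upd E e (Bel a phi) <==>
          (ev_pre E e ==>
             (\big[@And At Ag/Top]_(f : E | ev_Qp a e f) All (Upd E f phi) &&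
              \big[@And At Ag/Top]_(f : E | ev_Q a e f) Bel a (Upd E f phi))))
| ax_A6 (E F : evmodel At Ag) (e : E) (f : F) phi :
    GDEL (Upd E e (Upd F f phi) <==> Upd (ecomp E F) (e, f) phi)
| rule_MP phi psi : GDEL (phi ==> psi) -> GDEL phi -> GDEL psi
| rule_AllNec phi : GDEL phi -> GDEL (All phi)
| rule_BelNec a phi : GDEL phi -> GDEL (Bel a phi)
| rule_UpdNec (E : evmodel At Ag) (e : E) phi : GDEL phi -> GDEL (Upd E e phi).

(* Main.v *)
(* Soundness: the only axiom that is not immediate is A6, where the iterated
   product (M * E) * F is bisimilar to M * (E o F) by reassociating triples.

   Completeness: axioms A1-A5, applied from the innermost update modality
   outwards, rewrite every formula to a provably equivalent one without update
   modalities; A6 only serves to show that [E,e]phi holds vacuously when pre(e)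
   fails, which yields monotonicity of [E,e].  For an update-free phi0 that is
   not provable, take rho consistent with ~phi0 and deciding all subformulas of
   phi0, and let T be the set of formulas psi with |- rho -> All psi, a normal
   theory that settles every All-subformula.  Worlds are the T-consistent
   formulas deciding all subformulas of phi0, and y is a-accessible from x
   unless T contains x -> B_a ~y; rho itself is a world refuting phi0. *)

Require Import Defs.
From mathcomp Require Import all_boot.
From mathcomp Require Import boolp.

Set Implicit Arguments.
Unset Strict Implicit.
Unset Printing Implicit Defensive.

Local Open Scope del_scope.

(** * Soundness, with bisimulation invariance for the composition axiom *)

Section Soundness.

Context {At : countType} {Ag : finType}.
Implicit Types (M N : kripke At Ag) (phi psi : form At Ag).

Lemma sat_imp M (w : M) phi psi :
  sat (phi ==> psi) w <-> (sat phi w -> sat psi w).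
Proof.
split=> /= [h hphi | h [hphi]]; last by apply; apply: h.
by apply: contrapT => hpsi; apply: h.
Qed.

Lemma sat_iff M (w : M) phi psi :
  sat (phi <==> psi) w <-> (sat phi w <-> sat psi w).
Proof.
split=> [[/sat_imp h1 /sat_imp h2] // | [h1 h2]].
by split; apply/sat_imp.
Qed.

Lemma sat_big_and M (w : M) (I : finType) (P : pred I) (F : I -> form At Ag) :
  sat (\big[@And At Ag/Top]_(i | P i) F i) w <->
  (forall i, P i -> sat (F i) w).
Proof.
have -> : (forall i, P i -> sat (F i) w) <->
          (forall i, i \in index_enum I -> P i -> sat (F i) w).
  by split=> h i => [_|]; apply: h => //; rewrite mem_index_enum.
elim: (index_enum I) => [|i r IH]; first by rewrite big_nil.
rewrite big_cons; case: ifP => Pi /=.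
  split=> [[hi /IH hr] j | h].
    by rewrite inE => /orP[/eqP -> | /hr].
  split; first by apply: h => //; rewrite mem_head.
  by apply/IH => j jr; apply: h; rewrite inE jr orbT.
rewrite IH; split=> h j jr; last by apply: h; rewrite inE jr orbT.
by move: jr; rewrite inE => /orP[/eqP -> | /h //]; rewrite Pi.
Qed.

(** Truth at a fixed world is one of the valuations quantified over in [tautology], which makes CL
    sound. *)
Lemma peval_asbool M (w : M) phi :
  peval (fun psi => `[< sat psi w >]) phi = `[< sat phi w >].
Proof.
elim: phi => //=.
- by apply/esym/asboolP.
- by move=> phi ->; rewrite asbool_neg.
- by move=> phi -> psi ->; rewrite asbool_and.
Qed.

(** The base point enters [product] only through a proof of [inhabited], so proof irrelevance
    identifies the two models. This lets updates taken at different points be compared. *)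
Lemma sat_product (M : kripke At Ag) (F : evframe Ag) (P : M -> F -> Prop)
    (x0 x1 x : {y : M * F | P y.1 y.2}) phi :
  @sat At Ag phi (product x0) x -> @sat At Ag phi (product x1) x.
Proof. by rewrite /product (Prop_irrelevance (inhabits x0) (inhabits x1)). Qed.

(** Totality on both sides serves the universal modality and the [ev_Qp] arrows of a product, whose
    targets may be any surviving worlds. *)
Record bisim M N (Z : M -> N -> Prop) : Prop := Bisim {
  bisim_atom : forall x y p, Z x y -> val_atom p x <-> val_atom p y;
  bisim_forth : forall x y a x', Z x y -> acc a x x' ->
    exists2 y', acc a y y' & Z x' y';
  bisim_back : forall x y a y', Z x y -> acc a y y' ->
    exists2 x', acc a x x' & Z x' y';
  bisim_left : forall x, exists y, Z x y;
  bisim_right : forall y, exists x, Z x y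
}.

(** An [ev_Qp] arrow is matched through totality of [Z], an [ev_Q] arrow through forth or back.
    Agreement of [P] and [Q] along [Z] makes the matching world survive the update. *)
Lemma bisim_product M N (Z : M -> N -> Prop) (F : evframe Ag)
    (P : M -> F -> Prop) (Q : N -> F -> Prop)
    (x0 : {x : M * F | P x.1 x.2}) (y0 : {y : N * F | Q y.1 y.2}) :
    bisim Z -> (forall x y f, Z x y -> P x f <-> Q y f) ->
  @bisim (product x0) (product y0)
    (fun x y => Z (sval x).1 (sval y).1 /\ (sval x).2 = (sval y).2).
Proof.
move=> bZ PQ; split.
- by move=> x y p [Zxy _]; apply: (bisim_atom bZ).
- move=> [[w e] hx] [[v f] hy] a [[w' e'] hx'] [/= Zwv ->] [eQ | [ww' eQ]].
    have [v' Zv'] := bisim_left bZ w'.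
    have hv' : Q v' e' by apply/(PQ _ _ _ Zv').
    by exists (exist _ (v', e') hv') => /=; first left.
  have [v' vv' Zv'] := bisim_forth bZ Zwv ww'.
  have hv' : Q v' e' by apply/(PQ _ _ _ Zv').
  by exists (exist _ (v', e') hv') => /=; first right.
- move=> [[w f] hx] [[v e] hy] a [[v' e'] hy'] [/= Zwv ->] [eQ | [vv' eQ]].
    have [w' Zw'] := bisim_right bZ v'.
    have hw' : P w' e' by apply/(PQ _ _ _ Zw').
    by exists (exist _ (w', e') hw') => /=; first left.
  have [w' ww' Zw'] := bisim_back bZ Zwv vv'.
  have hw' : P w' e' by apply/(PQ _ _ _ Zw').
  by exists (exist _ (w', e') hw') => /=; first right.
- move=> [[w e] hx]; have [v Zv] := bisim_left bZ w.
  have hv : Q v e by apply/(PQ _ _ _ Zv).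
  by exists (exist _ (v, e) hv).
- move=> [[v e] hy]; have [w Zw] := bisim_right bZ v.
  have hw : P w e by apply/(PQ _ _ _ Zw).
  by exists (exist _ (w, e) hw).
Qed.

(** The induction also runs through the preconditions, which gives the agreement that
    [bisim_product] asks for. Models stay general because an update changes them. *)
Lemma sat_bisim phi M N (Z : M -> N -> Prop) x y :
  bisim Z -> Z x y -> sat phi x <-> sat phi y.
Proof.
elim: phi M N Z x y => //=.
- by move=> p M N Z x y bZ; apply: bisim_atom.
- by move=> phi IH M N Z x y bZ Zxy; rewrite (IH _ _ _ _ _ bZ Zxy).
- move=> phi IH psi IH' M N Z x y bZ Zxy.
  by rewrite (IH _ _ _ _ _ bZ Zxy) (IH' _ _ _ _ _ bZ Zxy).
- move=> a phi IH M N Z x y bZ Zxy; split=> h v xv.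
    have [u xu Zuv] := bisim_back bZ Zxy xv.
    by apply/(IH _ _ _ _ _ bZ Zuv); apply: h.
  have [u xu Zuv] := bisim_forth bZ Zxy xv.
  by apply/(IH _ _ _ _ _ bZ Zuv); apply: h.
- move=> F pre IHpre e phi IH M N Z x y bZ Zxy.
  have PQ u v f : Z u v -> sat (pre f) u <-> sat (pre f) v.
    by apply: IHpre.
  split=> h hp.
    have hq : sat (pre e) x by apply/(PQ _ _ _ Zxy).
    by refine (proj1 (IH _ _ _ _ _ (bisim_product _ _ bZ PQ) _) (h hq)).
  have hq : sat (pre e) y by apply/(PQ _ _ _ Zxy).
  by refine (proj2 (IH _ _ _ _ _ (bisim_product _ _ bZ PQ) _) (h hq)).
- move=> phi IH M N Z x y bZ Zxy; split=> h v.
    have [u Zuv] := bisim_right bZ v.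
    by apply/(IH _ _ _ _ _ bZ Zuv).
  have [u Zuv] := bisim_left bZ v.
  by apply/(IH _ _ _ _ _ bZ Zuv).
Qed.

Definition update (E : evmodel At Ag) M (w : M) (e : E)
    (h : sat (ev_pre E e) w) : kripke At Ag :=
  @product At Ag M E (fun v f => sat (ev_pre E f) v) (exist _ (w, e) h).

Definition update_point (E : evmodel At Ag) M (w : M) (e : E)
  (h : sat (ev_pre E e) w) : update h := exist _ (w, e) h.

Lemma sat_upd (E : evmodel At Ag) (e : E) phi M (w : M) :
  sat (Upd E e phi) w <-> forall h : sat (ev_pre E e) w, sat phi (update_point h).
Proof. by []. Qed.

Lemma sat_ecomp_pre (E F : evmodel At Ag) (e : E) (f : F) M (w : M)
    (he : sat (ev_pre E e) w) :
  sat (ev_pre (ecomp E F) (e, f)) w <-> sat (ev_pre F f) (update_point he).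
Proof.
split=> /= [[_ /(_ he)] // | h].
by split=> // he'; rewrite (Prop_irrelevance he' he).
Qed.

Lemma sat_ecomp_update (E F : evmodel At Ag) (e : E) (f : F) phi M (w : M)
    (he : sat (ev_pre E e) w) (hf : sat (ev_pre F f) (update_point he))
    (hef : sat (ev_pre (ecomp E F) (e, f)) w) :
  sat phi (update_point hf) <->
  sat phi (@update_point (ecomp E F) M w (e, f) hef).
Proof.
pose Z (x : update hf) (y : @update (ecomp E F) M w (e, f) hef) :=
  sval (sval x).1 = ((sval y).1, (sval y).2.1) /\ (sval x).2 = (sval y).2.2.
apply: (@sat_bisim _ _ _ Z) => //; split; rewrite /Z.
- by move=> [[[[u a] h1] b] h2] [[v [c d]] h3] p [[/= -> _] _].
- move=> [[[[u c0] h1] d0] h2] [[v [c d]] h3] a [[[[u' c'] h1'] d'] h2'] /=.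
  move=> [[-> ->] ->] huu'.
  have h : sat (ev_pre (ecomp E F) (c', d')) u'.
    by apply/(sat_ecomp_pre d' h1')/(sat_product _ h2').
  exists (exist _ (u', (c', d')) h) => //=.
  (* The cases are an [ev_Qp] arrow of [F], an [ev_Qp] arrow of [E] kept by [ev_Q] of [F], and an
     arrow of [M] kept by both [ev_Q]. The first two are the disjuncts of [ev_Qp] in
     [comp_frame]. *)
  case: huu' => [-> | [[q | [uu' q]] ->]]; [left | left | right] => //=.
    by rewrite q orbT.
  by rewrite q.
- move=> [[[[u c0] h1] d0] h2] [[v [c d]] h3] a [[u' [c' d']] h3'] /=.
  move=> [[-> ->] ->] huu'.
  have h : sat (ev_pre E c') u' by case: h3'.
  have h2' := sat_product (update_point he) (proj1 (sat_ecomp_pre d' h) h3').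
  exists (exist _ (exist _ (u', c') h, d') h2') => //=.
  case: huu' => [/orP[q | /andP[-> q]] | [uu' /andP[q ->]]]; first by left.
    by right; split=> //; left.
  by right; split=> //; right.
- move=> [[[[u' c'] h1'] d'] h2'].
  have h : sat (ev_pre (ecomp E F) (c', d')) u'.
    by apply/(sat_ecomp_pre d' h1')/(sat_product _ h2').
  by exists (exist _ (u', (c', d')) h).
- move=> [[u' [c' d']] h3'].
  have h : sat (ev_pre E c') u' by case: h3'.
  have h2' := sat_product (update_point he) (proj1 (sat_ecomp_pre d' h) h3').
  by exists (exist _ (exist _ (u', c') h, d') h2').
Qed.

Lemma sat_ecomp (E F : evmodel At Ag) (e : E) (f : F) phi M (w : M) :
  sat (Upd E e (Upd F f phi)) w <-> sat (Upd (ecomp E F) (e, f) phi) w.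
Proof.
split=> /sat_upd h; apply/sat_upd; [move=> hef | move=> he].
  have he : sat (ev_pre E e) w by case: hef.
  have hf := proj1 (sat_ecomp_pre f he) hef.
  by apply/(sat_ecomp_update phi hf hef); move: (h he) => /sat_upd; apply.
apply/sat_upd => hf; have hef := proj2 (sat_ecomp_pre f he) hf.
exact/(sat_ecomp_update phi hf hef)/(h hef).
Qed.

Lemma soundness phi : GDEL phi -> valid phi.
Proof.
elim=> {phi}.
- move=> phi taut M w.
  by move: (taut (fun psi => `[< sat psi w >])); rewrite peval_asbool => /asboolP.
- move=> phi psi M w; apply/sat_imp => h; apply/sat_imp => hphi v.
  by move/sat_imp: (h v); apply; apply: hphi.
- by move=> phi M w; apply/sat_imp => h; apply: h.
- by move=> phi M w; apply/sat_imp => h.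
- by move=> a phi M w; apply/sat_imp => h v _; apply: h.
- move=> a phi psi M w; apply/sat_imp => h; apply/sat_imp => hphi v wv.
  by move/sat_imp: (h v wv); apply; apply: hphi.
- by move=> E e p M w; apply/sat_iff; rewrite sat_imp.
- move=> E e phi M w; apply/sat_iff; rewrite sat_imp /=.
  split=> [h he | h he he']; first by move=> /(_ he); apply: h.
  by apply: (h he) => he''; rewrite (Prop_irrelevance he'' he).
- move=> E e phi psi M w; apply/sat_iff => /=.
  by split=> [h | [h h'] he]; split=> *; [case: (h _) | case: (h _) | apply: h | apply: h'].
- move=> E e phi M w; apply/sat_iff; rewrite sat_imp sat_big_and /=.
  split=> [h he f _ v hf | h he [[v f] hf]].
    exact: sat_product (h he _).
  exact: sat_product (h he f isT v hf).
- move=> E e a phi M w; apply/sat_iff; rewrite sat_imp /= !sat_big_and /=.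
  split=> [h he | h he [[v f] hf] /=].
    split=> [f ef v | f ef v wv] hf.
      by apply: sat_product (h he (exist _ (v, f) hf) _) => /=; left.
    by apply: sat_product (h he (exist _ (v, f) hf) _) => /=; right.
  have [h1 h2] := h he.
  move=> [ef | [wv ef]]; first exact: sat_product (h1 f ef v hf).
  exact: sat_product (h2 f ef v wv hf).
- by move=> E F e f phi M w; apply/sat_iff; apply: sat_ecomp.
- by move=> phi psi _ h _ hphi M w; move/sat_imp: (h M w); apply.
- by move=> phi _ h M w v; apply: h.
- by move=> a phi _ h M w v _; apply: h.
- by move=> E e phi _ h M w he; apply: h.
Qed.

End Soundness.

(** * Theories containing the theorems and propositional reasoning in them *)

Section PropositionalReasoning.

Context {At : countType} {Ag : finType}.
Implicit Types (phi psi chi : form At Ag) (T : form At Ag -> Prop).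

(* A theory closed under the rules of GDEL other than [rule_UpdNec]. *)
Record normal T : Prop := Normal {
  normal_thm : forall phi, GDEL phi -> T phi;
  normal_mp : forall phi psi, T (phi ==> psi) -> T phi -> T psi;
  normal_all : forall phi, T phi -> T (All phi);
  normal_bel : forall a phi, T phi -> T (Bel a phi)
}.

(** Necessitation is left out so that sets such as the formulas believed under an assumption also
    qualify. *)
Definition taut_closed T : Prop :=
  (forall phi, GDEL phi -> T phi) /\
  (forall phi psi, T (phi ==> psi) -> T phi -> T psi).

Lemma normal_taut_closed T : normal T -> taut_closed T.
Proof. by case. Qed.

Lemma normal_GDEL : normal (@GDEL At Ag).
Proof.
by split=> // *; [apply: rule_MP; eassumption | apply: rule_AllNec | apply: rule_BelNec].
Qed.

Lemma taut_closed_GDEL : taut_closed (@GDEL At Ag).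
Proof. exact: normal_taut_closed normal_GDEL. Qed.

Lemma taut1 T phi psi : taut_closed T ->
  T phi -> tautology (phi ==> psi) -> T psi.
Proof. by move=> [thm mp] h t; apply: mp h; apply/thm/ax_CL. Qed.

Lemma taut2 T phi psi chi : taut_closed T ->
  T phi -> T psi -> tautology (phi ==> (psi ==> chi)) -> T chi.
Proof. by move=> cT h h' t; apply: (proj2 cT) h'; apply: taut1 h t. Qed.

Lemma taut3 T phi psi chi theta : taut_closed T ->
    T phi -> T psi -> T chi -> tautology (phi ==> (psi ==> (chi ==> theta))) ->
  T theta.
Proof. by move=> cT h h' h'' t; apply: (proj2 cT) h''; apply: taut2 h h' t. Qed.

End PropositionalReasoning.

(** A truth table: after simplification every leaf is a schematic formula, seen as [peval v f], or a
    modal one, seen as [v f], and each is split on. *)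
Ltac tauto_form :=
  let v := fresh in move=> v; rewrite /Iff /Imp /=;
  repeat match goal with
    | |- context [peval ?v ?f] => case: (peval v f)
    | |- context [v ?f] => case: (v f)
  end; by [].

(** * Elimination of update modalities *)

Section Reduction.

Context {At : countType} {Ag : finType}.
Implicit Types (phi psi chi : form At Ag).

Local Notation cG := (@taut_closed_GDEL At Ag).

Lemma iff_refl phi : GDEL (phi <==> phi).
Proof. by apply: ax_CL; tauto_form. Qed.

Lemma iff_trans psi phi chi :
  GDEL (phi <==> psi) -> GDEL (psi <==> chi) -> GDEL (phi <==> chi).
Proof. by move=> h h'; apply: (taut2 cG h h'); tauto_form. Qed.

Lemma iff_imp phi psi : GDEL (phi <==> psi) -> GDEL (phi ==> psi).
Proof. by move=> h; apply: (taut1 cG h); tauto_form. Qed.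

Lemma iff_sym phi psi : GDEL (phi <==> psi) -> GDEL (psi <==> phi).
Proof. by move=> h; apply: (taut1 cG h); tauto_form. Qed.

Lemma iff_neg phi psi : GDEL (phi <==> psi) -> GDEL (~~ phi <==> ~~ psi).
Proof. by move=> h; apply: (taut1 cG h); tauto_form. Qed.

Lemma iff_and phi psi phi' psi' : GDEL (phi <==> phi') -> GDEL (psi <==> psi') ->
  GDEL (phi && psi <==> phi' && psi').
Proof. by move=> h h'; apply: (taut2 cG h h'); tauto_form. Qed.

Lemma iff_imp_cong phi psi phi' psi' :
    GDEL (phi <==> phi') -> GDEL (psi <==> psi') ->
  GDEL ((phi ==> psi) <==> (phi' ==> psi')).
Proof. by move=> h h'; apply: (taut2 cG h h'); tauto_form. Qed.

Lemma iff_big_and (I : finType) (P : pred I) (F G : I -> form At Ag) :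
    (forall i, GDEL (F i <==> G i)) ->
  GDEL (\big[@And At Ag/Top]_(i | P i) F i <==> \big[@And At Ag/Top]_(i | P i) G i).
Proof.
by move=> FG; elim/big_ind2: _ => // *; [apply: iff_refl | apply: iff_and].
Qed.

Lemma all_mono phi psi : GDEL (phi ==> psi) -> GDEL (All phi ==> All psi).
Proof. by move=> h; apply: rule_MP (ax_AllK _ _) (rule_AllNec h). Qed.

Lemma bel_mono a phi psi : GDEL (phi ==> psi) -> GDEL (Bel a phi ==> Bel a psi).
Proof. by move=> h; apply: rule_MP (ax_BK _ _ _) (rule_BelNec a h). Qed.

Lemma iff_all phi psi : GDEL (phi <==> psi) -> GDEL (All phi <==> All psi).
Proof.
move=> h; apply: (taut2 cG (all_mono (iff_imp h)) (all_mono (iff_imp (iff_sym h)))).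
by tauto_form.
Qed.

Lemma iff_bel a phi psi : GDEL (phi <==> psi) -> GDEL (Bel a phi <==> Bel a psi).
Proof.
move=> h.
apply: (taut2 cG (bel_mono a (iff_imp h)) (bel_mono a (iff_imp (iff_sym h)))).
by tauto_form.
Qed.

Lemma upd_vacuous (E : evmodel At Ag) (e : E) phi :
  GDEL (~~ ev_pre E e ==> Upd E e phi).
Proof.
elim: phi E e => [|p|phi _|phi IH psi IH'|a phi _|F pre _ f phi IH|phi _] E e.
- by apply: (taut1 cG (rule_UpdNec e (ax_CL (phi := Top) _))); tauto_form.
- by apply: (taut1 cG (ax_A1 e p)); tauto_form.
- by apply: (taut1 cG (ax_A2 e phi)); tauto_form.
- by apply: (taut3 cG (ax_A3 e phi psi) (IH E e) (IH' E e)); tauto_form.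
- by apply: (taut1 cG (ax_A5 e a phi)); tauto_form.
(* The precondition of the composite has [ev_pre E e] as a conjunct, so it fails as well; the
   induction hypothesis covers all event models, hence this one. *)
- have := IH (ecomp E (EvModel pre)) (e, f).
  by move=> h; apply: (taut2 cG (@ax_A6 _ _ E (EvModel pre) e f phi) h); tauto_form.
- by apply: (taut1 cG (ax_A4 e phi)); tauto_form.
Qed.

(** This replaces a K axiom for updates. An implication is [~~ (phi && ~~ psi)], so A2 and A3 unfold
    its necessitation, which settles the case where the precondition holds; [upd_vacuous] settles
    the other. *)
Lemma upd_mono (E : evmodel At Ag) (e : E) phi psi :
  GDEL (phi ==> psi) -> GDEL (Upd E e phi ==> Upd E e psi).
Proof.
move=> /(rule_UpdNec e) h.
have h1 : GDEL (ev_pre E e ==> ~~ (Upd E e phi && Upd E e (~~ psi))).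
  by apply: (taut3 cG h (ax_A2 e (phi && ~~ psi)) (ax_A3 e phi (~~ psi))); tauto_form.
by apply: (taut3 cG h1 (ax_A2 e psi) (upd_vacuous e psi)); tauto_form.
Qed.

Lemma iff_upd (E : evmodel At Ag) (e : E) phi psi :
  GDEL (phi <==> psi) -> GDEL (Upd E e phi <==> Upd E e psi).
Proof.
move=> h.
apply: (taut2 cG (upd_mono e (iff_imp h)) (upd_mono e (iff_imp (iff_sym h)))).
by tauto_form.
Qed.

Fixpoint static phi : bool :=
  match phi with
  | Top | Atom _ => true
  | Neg psi | Bel _ psi | All psi => static psi
  | And psi chi => (static psi && static chi)%B
  | Dyn _ _ _ _ => false
  end.

(* [upd_red t e psi] is [Upd E e psi] with A1-A5 applied exhaustively, where
   [t f] stands for the precondition of [f]; it is only meant for static [psi]. *)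
Fixpoint upd_red (F : evframe Ag) (t : F -> form At Ag) (e : F) psi : form At Ag :=
  match psi with
  | Top | Dyn _ _ _ _ => Top
  | Atom p => t e ==> Atom p
  | Neg chi => t e ==> ~~ upd_red t e chi
  | And chi chi' => upd_red t e chi && upd_red t e chi'
  | Bel a chi => t e ==>
      (\big[@And At Ag/Top]_(f : F | ev_Qp a e f) All (upd_red t f chi) &&
       \big[@And At Ag/Top]_(f : F | ev_Q a e f) Bel a (upd_red t f chi))
  | All chi => t e ==> \big[@And At Ag/Top]_(f : F) All (upd_red t f chi)
  end.

Fixpoint reduct phi : form At Ag :=
  match phi with
  | Top => Top
  | Atom p => Atom p
  | Neg psi => ~~ reduct psi
  | And psi chi => reduct psi && reduct chi
  | Bel a psi => Bel a (reduct psi)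
  | Dyn F pre e psi => upd_red (fun f => reduct (pre f)) e (reduct psi)
  | All psi => All (reduct psi)
  end.

Lemma static_big_and (I : finType) (P : pred I) (F : I -> form At Ag) :
  (forall i, static (F i)) -> static (\big[@And At Ag/Top]_(i | P i) F i).
Proof. by move=> sF; elim/big_ind: _ => //= x y -> ->. Qed.

Lemma static_upd_red (F : evframe Ag) (t : F -> form At Ag) e psi :
  (forall f, static (t f)) -> static (upd_red t e psi).
Proof.
move=> st; elim: psi e => //= [p|psi IH|psi IH chi IH'|a psi IH|psi IH] e.
- by rewrite st.
- by rewrite st IH.
- by rewrite IH IH'.
- by rewrite st !static_big_and.
- by rewrite st static_big_and.
Qed.

Lemma static_reduct phi : static (reduct phi).
Proof.
by elim: phi => //= [phi -> psi -> //|F pre IH e phi _]; apply: static_upd_red.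
Qed.

(** Each axiom pushes the update below one connective. Where the precondition surfaces it is a plain
    antecedent, so the provably equivalent [t e] can replace it. *)
Lemma iff_upd_red (E : evmodel At Ag) (t : E -> form At Ag) e psi :
    (forall f, GDEL (ev_pre E f <==> t f)) -> static psi ->
  GDEL (Upd E e psi <==> upd_red t e psi).
Proof.
move=> pre_t; elim: psi e => //= [|p|psi IH|psi IH chi IH'|a psi IH|psi IH] e.
- by move=> _; apply: (taut1 cG (rule_UpdNec e (ax_CL (phi := Top) _))); tauto_form.
- move=> _; apply: iff_trans (ax_A1 _ _) _.
  exact: iff_imp_cong (pre_t e) (iff_refl _).
- move=> s; apply: iff_trans (ax_A2 _ _) _.
  exact: iff_imp_cong (pre_t e) (iff_neg (IH e s)).
- move=> /andP[s s']; apply: iff_trans (ax_A3 _ _ _) _.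
  exact: iff_and (IH e s) (IH' e s').
- move=> s; apply: iff_trans (ax_A5 _ _ _) _.
  apply: iff_imp_cong (pre_t e) _; apply: iff_and; apply: iff_big_and => f.
    exact: iff_all (IH f s).
  exact: iff_bel (IH f s).
- move=> s; apply: iff_trans (ax_A4 _ _) _.
  by apply: iff_imp_cong (pre_t e) _; apply: iff_big_and => f; apply: iff_all (IH f s).
Qed.

Lemma iff_reduct phi : GDEL (phi <==> reduct phi).
Proof.
elim: phi => /= [|p|phi IH|phi IH psi IH'|a phi IH|F pre IHpre e phi IH|phi IH].
- exact: iff_refl.
- exact: iff_refl.
- exact: iff_neg.
- exact: iff_and.
- exact: iff_bel.
- apply: iff_trans (iff_upd (E := EvModel pre) e IH) _.
  exact: (@iff_upd_red (EvModel pre)) (static_reduct phi).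
- exact: iff_all.
Qed.

End Reduction.

(** * Deciding subformulas, and normal theories *)

Section StaticCompleteness.

Context {At : countType} {Ag : finType}.
Implicit Types (phi psi chi theta rho : form At Ag) (T Q : form At Ag -> Prop).

(** A single formula [theta] plays the part of a maximal consistent set. *)
Fixpoint decides T theta phi : Prop :=
  (T (theta ==> phi) \/ T (theta ==> ~~ phi)) /\
  match phi with
  | Neg psi | Bel _ psi | All psi => decides T theta psi
  | And psi chi => decides T theta psi /\ decides T theta chi
  | _ => True
  end.

Lemma decidesW T theta phi :
  decides T theta phi -> T (theta ==> phi) \/ T (theta ==> ~~ phi).
Proof. by case: phi => [|?|?|? ?|? ?|? ? ? ?|?] []. Qed.

Lemma decides_strengthen T theta theta' phi : taut_closed T ->
  T (theta' ==> theta) -> decides T theta phi -> decides T theta' phi.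
Proof.
move=> cT h.
have step psi : T (theta ==> psi) \/ T (theta ==> ~~ psi) ->
    T (theta' ==> psi) \/ T (theta' ==> ~~ psi).
  by case=> h'; [left | right]; apply: (taut2 cT h h'); tauto_form.
elim: phi => /= [|p|phi IH|phi IH psi IH'|a phi IH|F pre _ e phi _|phi IH].
all: move=> [/step ? ]; tauto.
Qed.

(* Lindenbaum's lemma, relative to the subformulas of a single formula. *)
Lemma exists_decides T Q phi theta : taut_closed T -> taut_closed Q ->
    ~ Q (~~ theta) ->
  exists theta', [/\ ~ Q (~~ theta'), T (theta' ==> theta) & decides T theta' phi].
Proof.
move=> cT cQ.
(* [Q] measures consistency and [T] entailment. If [Q] refutes [chi && psi], then [chi && ~~ psi] is
   consistent, for otherwise [Q] would refute [chi]. *)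
have split1 psi chi : ~ Q (~~ chi) -> exists chi', [/\ ~ Q (~~ chi'), T (chi' ==> chi)
    & T (chi' ==> psi) \/ T (chi' ==> ~~ psi)].
  move=> hchi; have [h | h] := pselect (Q (~~ (chi && psi))).
    exists (chi && ~~ psi); split.
    - by move=> h'; apply: hchi; apply: (taut2 cQ h h'); tauto_form.
    - by apply: (proj1 cT); apply: ax_CL; tauto_form.
    - by right; apply: (proj1 cT); apply: ax_CL; tauto_form.
  exists (chi && psi); split=> //; last left.
  - by apply: (proj1 cT); apply: ax_CL; tauto_form.
  - by apply: (proj1 cT); apply: ax_CL; tauto_form.
have impT chi psi theta' : T (theta' ==> psi) -> T (psi ==> chi) -> T (theta' ==> chi).
  by move=> h h'; apply: (taut2 cT h h'); tauto_form.
have str := @decides_strengthen T _ _ _ cT.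
elim: phi theta => [|p|phi IH|phi IH psi IH'|a phi IH|F pre _ e phi _|phi IH] theta htheta /=.
- by have [t [? ? ?]] := split1 Top _ htheta; exists t.
- by have [t [? ? ?]] := split1 (Atom p) _ htheta; exists t.
- have [t [ht htt d]] := split1 (Neg phi) _ htheta.
  have [t' [ht' htt' d']] := IH _ ht.
  exists t'; split=> //; first exact: impT htt' htt.
  split=> //; case: d => d; [left | right]; exact: impT htt' d.
- have [t [ht htt d]] := split1 (And phi psi) _ htheta.
  have [t' [ht' htt' d']] := IH _ ht.
  have [t'' [ht'' htt'' d'']] := IH' _ ht'.
  have h : T (t'' ==> t) by exact: impT htt'' htt'.
  exists t''; split=> //; first exact: impT h htt.
  split; last by split=> //; exact: str htt'' d'.
  by case: d => d; [left | right]; exact: impT h d.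
- have [t [ht htt d]] := split1 (Bel a phi) _ htheta.
  have [t' [ht' htt' d']] := IH _ ht.
  exists t'; split=> //; first exact: impT htt' htt.
  split=> //; case: d => d; [left | right]; exact: impT htt' d.
- by have [t [? ? ?]] := split1 (Dyn pre e phi) _ htheta; exists t.
- have [t [ht htt d]] := split1 (All phi) _ htheta.
  have [t' [ht' htt' d']] := IH _ ht.
  exists t'; split=> //; first exact: impT htt' htt.
  split=> //; case: d => d; [left | right]; exact: impT htt' d.
Qed.

(** With this set as [Q] in [exists_decides], consistency of the new formula says exactly that it is
    [a]-accessible from [theta] in [canon]. *)
Lemma taut_closed_imp_bel T theta a :
  normal T -> taut_closed (fun psi => T (theta ==> Bel a psi)).
Proof.
move=> nT; have cT := normal_taut_closed nT; split=> [phi h | phi psi h h'].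
  by apply: (taut1 cT (normal_bel nT a (normal_thm nT h))); tauto_form.
by apply: (taut3 cT (normal_thm nT (ax_BK a phi psi)) h h'); tauto_form.
Qed.

(* Positive introspection follows from T and 5. *)
Lemma all_4 phi : GDEL (All phi ==> All (All phi)).
Proof.
have cG := @taut_closed_GDEL At Ag.
(* By T, [All phi] implies [~~ All (~~ All phi)]; 5 puts [All] in front of that, and [h], the dual
   of 5, is then applied under this [All]. *)
have h : GDEL (~~ All (~~ All phi) ==> All phi).
  by apply: (taut1 cG (ax_All5 phi)); tauto_form.
have h1 := all_mono h.
have h2 := ax_AllT (~~ All phi).
have h3 := ax_All5 (~~ All phi).
by apply: (taut3 cG h1 h2 h3); tauto_form.
Qed.

(** Closure under both necessitations rests on positive introspection, for [Bel] combined with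
    [All phi ==> Bel a phi] under [All]. *)
Lemma normal_imp_all rho : normal (fun phi => GDEL (rho ==> All phi)).
Proof.
have cG := @taut_closed_GDEL At Ag.
split=> [phi h | phi psi h h' | phi h | a phi h].
- by apply: (taut1 cG (rule_AllNec h)); tauto_form.
- by apply: (taut3 cG (ax_AllK phi psi) h h'); tauto_form.
- by apply: (taut2 cG h (all_4 phi)); tauto_form.
- by apply: (taut3 cG h (all_4 phi) (all_mono (ax_AllB a phi))); tauto_form.
Qed.

(** * Canonical model and truth lemma *)

Section CanonicalModel.

Variables (T : form At Ag -> Prop) (root : form At Ag).
Hypothesis nT : normal T.

Definition canon_world theta : Prop := ~ T (~~ theta) /\ decides T theta root.

Variable w0 : {theta | canon_world theta}.

Definition canon : kripke At Ag :=
  {| world := {theta | canon_world theta};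
     world_nonempty := inhabits w0;
     acc := fun a x y => ~ T (sval x ==> Bel a (~~ sval y));
     val_atom := fun p x => T (sval x ==> Atom p) |}.

(** An [All]-formula has the same truth value at every world, so the theory itself has to settle
    it. *)
Fixpoint all_decided phi : Prop :=
  match phi with
  | Neg psi | Bel _ psi => all_decided psi
  | All psi => (T (All psi) \/ T (~~ All psi)) /\ all_decided psi
  | And psi chi => all_decided psi /\ all_decided chi
  | _ => True
  end.

Lemma truth_lemma phi : static phi -> all_decided phi ->
    (forall x : canon, decides T (sval x) phi) ->
  forall x : canon, sat phi x <-> T (sval x ==> phi).
Proof.
have cT := normal_taut_closed nT.
have incons (x : canon) psi : T (sval x ==> psi) -> T (sval x ==> ~~ psi) -> False.
  move=> h h'; case: (svalP x) => + _; apply.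
  by apply: (taut2 cT h h'); tauto_form.
elim: phi => //= [|phi IH|phi IH psi IH'|a phi IH|phi IH].
- by move=> _ _ _ x; split=> // _; apply: (proj1 cT); apply: ax_CL; tauto_form.
- move=> s ad dec x; rewrite IH // => [|y]; last by case: (dec y).
  have [_ d] := dec x.
  split; last by move=> h h'; apply: (incons x) h' h.
  by case: (decidesW d).
- move=> /andP[s s'] [ad ad'] dec x.
  rewrite IH // => [|y]; last by case: (dec y) => _ [].
  rewrite IH' // => [|y]; last by case: (dec y) => _ [].
  split=> [[h h'] | h]; first by apply: (taut2 cT h h'); tauto_form.
  by split; apply: (taut1 cT h); tauto_form.
- move=> s ad dec x.
  have {}IH (y : canon) : sat phi y <-> T (sval y ==> phi).
    by apply: IH => // z; case: (dec z).
  split=> [h | h y xy]; last first.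
    (* If [y] entailed [~~ phi], then [phi] would imply [~~ sval y], so [x], which entails
       [Bel a phi], would entail [Bel a (~~ sval y)], against accessibility. *)
    apply/IH; have [_ d] := dec y; case: (decidesW d) => // hy; case: xy.
    have hy' : T (phi ==> ~~ sval y) by apply: (taut1 cT hy); tauto_form.
    have := normal_mp nT (normal_thm nT (ax_BK a _ _)) (normal_bel nT a hy').
    by move=> hy''; apply: (taut2 cT h hy''); tauto_form.
  (* Suppose [x] rejects [Bel a phi]. Then [~~ phi] is compatible with the beliefs at [x] and
     extends to an accessible world, where [phi] fails. *)
  have [[//|hx] _] := dec x; exfalso.
  have cons : ~ T (sval x ==> Bel a (~~ ~~ phi)).
    have hb : GDEL (Bel a (~~ ~~ phi) ==> Bel a phi).
      by apply: bel_mono; apply: ax_CL; tauto_form.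
    move=> h'; apply: (incons x _ _ hx).
    by apply: (taut2 cT h' (normal_thm nT hb)); tauto_form.
  have [t [ht htt d]] :=
    exists_decides root cT (taut_closed_imp_bel (sval x) a nT) cons.
  have wt : canon_world t.
    split=> // h'; apply: ht.
    by apply: (taut1 cT (normal_bel nT a h')); tauto_form.
  by apply: (incons (exist _ t wt) phi) htt; apply/IH; apply: h.
- move=> s [ad ad'] dec x.
  have {}IH (y : canon) : sat phi y <-> T (sval y ==> phi).
    by apply: IH => // z; case: (dec z).
  split=> [h | h y].
    case: ad => hx; first by apply: (taut1 cT hx); tauto_form.
    (* If [~~ phi] were inconsistent, [T] would contain [phi] and hence [All phi], which together
       with [hx] contradicts the consistency of [x]. *)
    exfalso; have cons : ~ T (~~ ~~ phi).
      move=> h'; case: (svalP x) => + _; apply.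
      have h'' : T phi by apply: (taut1 cT h'); tauto_form.
      by apply: (taut2 cT (normal_all nT h'') hx); tauto_form.
    have [t [ht htt d]] := exists_decides root cT cT cons.
    have wt : canon_world t by [].
    by apply: (incons (exist _ t wt) phi) htt; apply/IH; apply: h.
  apply/IH; case: ad => hx.
    by apply: (taut2 cT hx (normal_thm nT (ax_AllT phi))); tauto_form.
  by case: (incons x (All phi)) => //; apply: (taut1 cT hx); tauto_form.
Qed.

End CanonicalModel.

(** * Completeness, first for static formulas and then in general *)

Lemma static_completeness phi : static phi -> valid phi -> GDEL phi.
Proof.
have cG := @taut_closed_GDEL At Ag.
move=> s val_phi; apply: contrapT => nphi.
have cons : ~ GDEL (~~ ~~ phi).
  by move=> h; apply: nphi; apply: (taut1 cG h); tauto_form.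
have [rho [hrho hphi d]] := exists_decides phi cG cG cons.
pose T psi := GDEL (rho ==> All psi).
have nT : normal T := normal_imp_all rho.
have consT psi : T psi -> GDEL (rho ==> psi).
  by move=> h; apply: (taut2 cG h (ax_AllT psi)); tauto_form.
have dT psi : decides (@GDEL At Ag) rho psi -> decides T rho psi.
  have step chi : GDEL (rho ==> chi) \/ GDEL (rho ==> ~~ chi) ->
      T (rho ==> chi) \/ T (rho ==> ~~ chi).
    by case=> h; [left | right]; apply: normal_thm nT _ h.
  elim: psi => /= [|p|psi IH|psi IH chi IH'|a psi IH|F pre _ e psi _|psi IH];
    by move=> [/step ? ?]; tauto.
(* What [rho] decides about an [All]-formula holds globally: positive answers by introspection,
   negative ones by axiom 5. *)
have adT psi : decides (@GDEL At Ag) rho psi -> all_decided T psi.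
  elim: psi => //= [psi IH [_ /IH] //|psi IH chi IH' [_ [/IH ? /IH' ?]] //|a psi IH [_ /IH] //|].
  move=> psi IH [h /IH ?]; split=> //; case: h => h; [left | right].
    by apply: (taut2 cG h (all_4 psi)); tauto_form.
  by apply: (taut2 cG h (ax_All5 psi)); tauto_form.
(* By T, a refutation of [rho] in [T] yields [rho ==> ~~ rho], making [~~ rho] provable. *)
have w : canon_world T phi rho.
  split; last exact: dT.
  by move=> /consT h; apply: hrho; apply: (taut1 cG h); tauto_form.
pose M := canon (exist (canon_world T phi) rho w).
have /truth_lemma : sat phi (exist _ rho w : M) by apply: val_phi.
have decM (x : M) : decides T (sval x) phi by case: (svalP x).
move=> /(_ nT s (adT _ d) decM) /consT h.
by apply: hrho; apply: (taut2 cG h hphi); tauto_form.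
Qed.

End StaticCompleteness.

Theorem theorem7p7 (At : countType) (Ag : finType) (phi : form At Ag) :
  GDEL phi <-> valid phi.
Proof.
split=> [|val_phi]; first exact: soundness.
have red := iff_reduct phi.
have h : GDEL (reduct phi).
  apply: static_completeness (static_reduct phi) _ => M w.
  (* Soundness of the provable equivalence transfers validity to the reduct. *)
  by have /sat_iff[h _] := soundness red w; apply: h; apply: val_phi.
by apply: rule_MP h; apply: iff_imp; apply: iff_sym.
Qed.
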